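(* Let $d\in\mathbb R^n$ be any fixed probability vector on $\mathcal S\times\mathcal A$ (nonnegative entries, possibly some zero, with $d^\top\mathbf 1=1$). Let $\rho_d$ be the joint spectral radius of the family $\{D_\mu^{(d)}:\mu\text{ a stochastic stationary policy}\}$ of linear maps on $\mathbb R\times W_d$ associated with the $d$-weighted deflated Q-value iteration \[ Q_{k+1}=F(Q_k)+\frac{\gamma}{1-\gamma}\,d^\top(F(Q_k)-Q_k)\,\mathbf 1 . \] Then \[ \rho_d=\bar\rho\le\gamma, \] where $\bar\rho$ is the projected joint spectral radius. Consequently, $\rho_d$ equals the joint spectral radius of the family $\{D^{(d_0)}_\mu:\mu\text{ a stochastic stationary policy}\}$ associated with the uniform deflated iteration, where $d_0=\frac1n\mathbf 1$.
   Context: Setting: a finite discounted Markov decision process with finite nonempty state space $\mathcal S$, finite nonempty action space $\mathcal A$, transition probabilities $P(s'\mid s,a)$, real rewards $r(s,a,s')$, discount factor $\gamma\in(0,1)$, and expected reward $R(s,a):=\sum_{s'}P(s'\mid s,a)r(s,a,s')$. Put $n:=|\mathcal S||\mathcal A|$; vectors in $\mathbb R^n$ are indexed by pairs $(s,a)$. The Bellman optimality operator $F:\mathbb R^n\to\mathbb R^n$ is $(FQ)(s,a):=R(s,a)+\gamma\sum_{s'}P(s'\mid s,a)\max_{a'}Q(s',a')$. $\mathbf 1$ is the all-ones vector, $\operatorname{span}(\mathbf 1)^\perp=\{x\in\mathbb R^n:\mathbf 1^\top x=0\}$, and $\boldsymbol{\Pi}_\perp:=I-\frac1n\mathbf 1\mathbf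 1^\top$. A stochastic stationary policy is a map $\mu$ assigning to each $s\in\mathcal S$ a probability distribution $\mu(\cdot\mid s)$ on $\mathcal A$; $\Theta$ is the set of deterministic policies $\pi:\mathcal S\to\mathcal A$, identified with one-hot stochastic policies. $A_\mu\in\mathbb R^{n\times n}$ has entries $A_\mu((s,a),(s',a')):=\gamma P(s'\mid s,a)\,\mu(a'\mid s')$. For a probability vector $d$ put $\boldsymbol{\Pi}_d:=I-\mathbf 1 d^\top$ (a generally oblique projection) and $W_d:=\{x\in\mathbb R^n:d^\top x=0\}$, and \[ D_\mu^{(d)}:=\begin{bmatrix}0&\frac{1}{1-\gamma}d^\top A_\mu\\0&\boldsymbol{\Pi}_dA_\mu\boldsymbol{\Pi}_d\end{bmatrix}, \] regarded as a linear map on $\mathbb R\times W_d$, with the lower-right block a linear map $W_d\to W_d$. The joint spectral radius of a bounded set $\mathcal H$ of linear maps on a finite-dimensional real space is $\rho(\mathcal H):=\lim_{k\to\infty}\sup_{A_1,\dots,A_k\in\mathcal H}\|A_k\cdots A_1\|^{1/k}$ for any submultiplicative operator norm (the value does not depend on the norm). The projected joint spectral radius is $\bar\rho:=\rho(\{\boldsymbol{\Pi}_\perp A_\pi\boldsymbol{\Pi}_\perp:\pi\in\Theta\})$, each map being regarded as a linear map on $\operatorname{span}(\mathbf 1)^\perp$. *)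

(* Defs.v *)
From HB Require Import structures.
From mathcomp Require Import all_boot all_order all_algebra.
From mathcomp Require Import boolp classical_sets reals topology normedtype.
From mathcomp Require Import sequences exp.
From mathcomp Require Import ring lra.

Set Implicit Arguments.
Unset Strict Implicit.
Unset Printing Implicit Defensive.

Import Order.TTheory GRing.Theory Num.Theory.
Import numFieldNormedType.Exports.

Local Open Scope classical_set_scope.
Local Open Scope ring_scope.

Record submult_norm (R : realType) (V : vectType R) := SubmultNorm {
  snorm :> 'End(V) -> R ;
  snorm_ge0 : forall f, 0 <= snorm f ;
  snorm_eq0 : forall f, snorm f = 0 -> f = 0 ;
  snormZ : forall c f, snorm (c *: f) = `|c| * snorm f ;
  snormD : forall f g, snorm (f + g) <= snorm f + snorm g ;
  snormM : forall f g, snorm (f \o g)%VF <= snorm f * snorm g }.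

(* A (k-1) \o ... \o A 0 *)
Fixpoint iter_comp (R : realType) (V : vectType R) (A : nat -> 'End(V))
    (k : nat) : 'End(V) :=
  if k is k'.+1 then (A k' \o iter_comp A k')%VF else \1%VF.

Definition jsr_seq (R : realType) (V : vectType R) (N : submult_norm V)
    (H : set 'End(V)) (k : nat) : R :=
  sup [set N (iter_comp A k) `^ (k%:R^-1)
      | A in [set A : nat -> 'End(V) | forall i, (i < k)%N -> H (A i)]].

(* The real-valued [sup] and [lim] take junk values on unbounded sets and on
   divergent sequences, so [jsr N H] is to be read together with boundedness
   of [H] and convergence of [jsr_seq N H]. *)
Definition jsr (R : realType) (V : vectType R) (N : submult_norm V)
    (H : set 'End(V)) : R :=
  limn (jsr_seq N H).

(* [state0] and [action0] only witness nonemptiness of S and A. *)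
Record mdp (R : realType) (S A : finType) := Mdp {
  state0 : S ;
  action0 : A ;
  trans : S -> A -> S -> R ;
  trans_ge0 : forall s a s', 0 <= trans s a s' ;
  trans_sum1 : forall s a, \sum_s' trans s a s' = 1 ;
  reward : S -> A -> S -> R ;
  discount : R ;
  discount_gt0 : 0 < discount ;
  discount_lt1 : discount < 1 }.

(* R^n with n = |S||A|: the coordinate of index i belongs to the pair
   [enum_val i], and [enum_rank (s, a)] is the index of the pair (s, a). *)
Notation npairs S A := #|{: S * A}|.

Definition is_policy (R : realType) (S A : finType) (mu : S -> A -> R) : Prop :=
  forall s, (forall a, 0 <= mu s a) /\ \sum_a mu s a = 1.

Definition one_hot (R : realType) (S A : finType) (pi : S -> A) : S -> A -> R :=
  fun s a => (a == pi s)%:R.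

Definition ones (R : realType) (n : nat) : 'cV[R]_n := const_mx 1.

Definition prob_vector (R : realType) (n : nat) (d : 'cV[R]_n) : Prop :=
  (forall i, 0 <= d i 0) /\ d^T *m ones R n = 1%:M.

Definition expected_reward (R : realType) (S A : finType) (M : mdp R S A)
    (s : S) (a : A) : R :=
  \sum_s' trans M s a s' * reward M s a s'.

Definition max_action (R : realType) (S A : finType) (M : mdp R S A)
    (Q : 'cV[R]_(npairs S A)) (s : S) : R :=
  \big[Num.max/Q (enum_rank (s, action0 M)) 0]_a Q (enum_rank (s, a)) 0.

Definition bellman (R : realType) (S A : finType) (M : mdp R S A)
    (Q : 'cV[R]_(npairs S A)) : 'cV[R]_(npairs S A) :=
  \col_i let: (s, a) := enum_val i in
    expected_reward M s a
    + discount M * \sum_s' trans M s a s' * max_action M Q s'.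

Definition deflated_step (R : realType) (S A : finType) (M : mdp R S A)
    (d Q : 'cV[R]_(npairs S A)) : 'cV[R]_(npairs S A) :=
  bellman M Q + (discount M / (1 - discount M)
                 * (d^T *m (bellman M Q - Q)) 0 0) *: ones R _.

Definition policy_mx (R : realType) (S A : finType) (M : mdp R S A)
    (mu : S -> A -> R) : 'M[R]_(npairs S A) :=
  \matrix_(i, j) let: (s, a) := enum_val i in let: (s', a') := enum_val j in
    discount M * trans M s a s' * mu s' a'.

(* {x | c^T x = 0}; this is W_d for c = d and span(1)^\perp for c = 1. *)
Definition annihv (R : realType) (n : nat) (c : 'cV[R]_n) : {vspace 'cV[R]_n} :=
  lker (linfun (mulmx c^T : 'cV[R]_n -> 'cV[R]_1)).

Definition oblique_proj (R : realType) (n : nat) (d : 'cV[R]_n) : 'M[R]_n :=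
  1%:M - ones R n *m d^T.

Definition perp_proj (R : realType) (n : nat) : 'M[R]_n :=
  1%:M - n%:R^-1 *: (ones R n *m (ones R n)^T).

(* The matrix B regarded as a linear map on U, meaningful when B maps U into
   itself; see [restr_mxE]. *)
Definition restr_mx (R : realType) (n : nat) (U : {vspace 'cV[R]_n})
    (B : 'M[R]_n) : 'End(subvs_of U) :=
  linfun (vsproj U \o (mulmx B \o vsval)).

Definition projected_map (R : realType) (S A : finType) (M : mdp R S A)
    (pi : S -> A) : 'End(subvs_of (annihv (ones R (npairs S A)))) :=
  restr_mx (annihv (ones R (npairs S A)))
    (perp_proj R (npairs S A) *m policy_mx M (one_hot R pi)
     *m perp_proj R (npairs S A)).

Definition projected_family (R : realType) (S A : finType) (M : mdp R S A) :
    set 'End(subvs_of (annihv (ones R (npairs S A)))) :=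
  range (projected_map M).

(* R x W_d, with (t, w) the block vector [t; w]. *)
Notation deflated_space R d :=
  ((R : realType)^o * subvs_of (annihv d))%type (only parsing).

Section DeflatedMap.
Variables (R : realType) (S A : finType) (M : mdp R S A).
Variables (d : 'cV[R]_(npairs S A)) (mu : S -> A -> R).

(* The block matrix D_mu^(d); its first block column is zero, so p.1 is unused. *)
Definition deflated_fun (p : deflated_space R d) : deflated_space R d :=
  ((1 - discount M)^-1 * (d^T *m policy_mx M mu *m vsval p.2) 0 0,
   restr_mx (annihv d)
     (oblique_proj d *m policy_mx M mu *m oblique_proj d) p.2).

Fact deflated_fun_linear : linear deflated_fun.
Proof.
move=> c p q; rewrite /deflated_fun; congr pair => /=; last by rewrite linearP.
rewrite mulmxDr -scalemxAr !mxE /GRing.scale /=.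
by rewrite mulrDr mulrCA.
Qed.

HB.instance Definition _ := GRing.isLinear.Build R
  (deflated_space R d) (deflated_space R d) _ deflated_fun
  deflated_fun_linear.

Definition deflated_map : 'End(deflated_space R d) := linfun deflated_fun.

End DeflatedMap.

Definition deflated_family (R : realType) (S A : finType) (M : mdp R S A)
    (d : 'cV[R]_(npairs S A)) : set 'End(deflated_space R d) :=
  [set deflated_map M d mu | mu in [set mu | is_policy mu]].
Arguments deflated_family {R S A} M d _.

Definition uniform_vector (R : realType) (n : nat) : 'cV[R]_n :=
  n%:R^-1 *: ones R n.

Lemma annihvP (R : realType) n (c x : 'cV[R]_n) :
  (x \in annihv c) = (c^T *m x == 0).
Proof. by rewrite memv_ker lfunE. Qed.

Lemma oblique_proj_annihv (R : realType) n (d x : 'cV[R]_n) :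
  prob_vector d -> oblique_proj d *m x \in annihv d.
Proof.
move=> [_ d1]; rewrite annihvP mulmxA /oblique_proj mulmxBr mulmx1 mulmxA d1.
by rewrite mul1mx subrr mul0mx.
Qed.

Lemma oblique_proj_uniform (R : realType) n :
  oblique_proj (uniform_vector R n) = perp_proj R n.
Proof. by rewrite /oblique_proj /uniform_vector linearZ /= -scalemxAr. Qed.

Lemma uniform_vector_prob (R : realType) (S A : finType) (M : mdp R S A) :
  prob_vector (uniform_vector R (npairs S A)).
Proof.
have n0 : (0 < npairs S A)%N by apply/card_gt0P; exists (state0 M, action0 M).
split=> [i|]; first by rewrite !mxE mulr1 invr_ge0 ler0n.
apply/matrixP=> i j; rewrite !ord1 !mxE.
under eq_bigr do rewrite !mxE !mulr1.
by rewrite sumr_const card_ord eqxx -[LHS]mulr_natr mulVf // pnatr_eq0 -lt0n.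
Qed.

Lemma restr_mxE (R : realType) n (U : {vspace 'cV[R]_n}) (B : 'M[R]_n) x :
  B *m vsval x \in U -> vsval (restr_mx U B x) = B *m vsval x.
Proof. by move=> BxU; rewrite lfunE /= vsprojK. Qed.

Lemma max_action_subP (R : realType) (S A : finType) (M : mdp R S A) Q Q' :
  exists2 mu : S -> A -> R, is_policy mu & forall s,
    max_action M Q s - max_action M Q' s
    = \sum_a mu s a * (Q - Q') (enum_rank (s, a)) 0.
Proof.
suff /choice[mu Hmu] : forall s, exists m : A -> R,
    ((forall a, 0 <= m a) /\ \sum_a m a = 1) /\
    max_action M Q s - max_action M Q' s
    = \sum_a m a * (Q - Q') (enum_rank (s, a)) 0.
  by exists mu => s; case: (Hmu s).
move=> s.
have maxP q : exists2 a, max_action M q s = q (enum_rank (s, a)) 0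
    & forall b, q (enum_rank (s, b)) 0 <= max_action M q s.
  have le b : q (enum_rank (s, b)) 0 <= max_action M q s by exact: (le_bigmax _ (fun b => q (enum_rank (s, b)) 0)).
  suff [a e] : exists a, max_action M q s = q (enum_rank (s, a)) 0 by exists a.
  rewrite /max_action; elim/big_ind: _ => [|x y [a ->] [b ->]|a _].
  - by exists (action0 M).
  - by case: leP => _; [exists b | exists a].
  - by exists a.
have [a Ea La] := maxP Q; have [b Eb Lb] := maxP Q'.
set D := _ - _.
pose x c := (Q - Q') (enum_rank (s, c)) 0.
have Dle : D <= x a by rewrite /D /x !mxE Ea lerD2l lerN2.
have Dge : x b <= D by rewrite /D /x !mxE Eb lerD2r.
have [t [t0 t1 Dt]] : exists t, [/\ 0 <= t, t <= 1 & D = t * x a + (1 - t) * x b].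
  have [e|ne] := eqVneq (x a) (x b).
    by exists 0; split=> //; rewrite ?ler01 // mul0r add0r subr0 mul1r; lra.
  have lt : 0 < x a - x b by rewrite subr_gt0 lt_neqAle eq_sym ne (le_trans Dge).
  exists ((D - x b) / (x a - x b)); split.
  - by rewrite divr_ge0 ?subr_ge0 // ltW // -subr_gt0.
  - by rewrite ler_pdivrMr // mul1r lerD2r.
  - by field; rewrite gt_eqF.
exists (fun c => t * (c == a)%:R + (1 - t) * (c == b)%:R).
have sum1 (u : A) f : \sum_c (c == u)%:R * f c = f u :> R.
  rewrite (bigD1 u) //= eqxx mul1r big1 ?addr0 // => c /negPf->.
  by rewrite mul0r.
split; first split.
- by move=> c; rewrite addr_ge0 // mulr_ge0 ?subr_ge0 ?ler0n.
- rewrite big_split /= -!mulr_sumr.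
  under eq_bigr do rewrite -[_%:R]mulr1.
  rewrite (sum1 a (fun=> 1)).
  under eq_bigr do rewrite -[_%:R]mulr1.
  by rewrite (sum1 b (fun=> 1)); ring.
- under eq_bigr do rewrite mulrDl -!mulrA.
  by rewrite big_split /= -!mulr_sumr !sum1.
Qed.

Lemma bellman_subP (R : realType) (S A : finType) (M : mdp R S A) Q Q' :
  exists2 mu : S -> A -> R, is_policy mu
    & bellman M Q - bellman M Q' = policy_mx M mu *m (Q - Q').
Proof.
have [mu Hmu E] := max_action_subP M Q Q'; exists mu => //.
apply/matrixP => i j; rewrite ord1 {j} [in LHS]mxE [in X in _ + X]mxE !mxE.
case ei: (enum_val i) => [s a].
rewrite addrAC opprD addrA subrr add0r addrC -mulrBr -sumrB.
under eq_bigr do rewrite -mulrBr E mulr_sumr.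
rewrite pair_big /= mulr_sumr.
rewrite (reindex (@enum_val _ predT)) /=; last first.
  by apply: onW_bij; exact: enum_val_bij.
apply: eq_bigr => j _; rewrite [in RHS]mxE ei.
by rewrite -surjective_pairing enum_valK; case: (enum_val j) => s' a' /=; rewrite !mulrA.
Qed.

(* The coordinates of x = (d^T x) 1 + Pi_d x in R x W_d. *)
Definition deflated_coord (R : realType) (S A : finType)
    (d x : 'cV[R]_(npairs S A)) : deflated_space R d :=
  ((d^T *m x) 0 0, vsproj (annihv d) (oblique_proj d *m x)).

Lemma policy_mx_ones (R : realType) (S A : finType) (M : mdp R S A)
    (mu : S -> A -> R) : is_policy mu ->
  policy_mx M mu *m ones R _ = discount M *: ones R _.
Proof.
move=> Hmu; apply/matrixP=> i j; rewrite !mxE.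
case ei: (enum_val i) => [s a].
transitivity (\sum_(p : S * A) discount M * trans M s a p.1 * mu p.1 p.2).
  rewrite [RHS](reindex (@enum_val _ predT)) /=; last first.
    by apply: onW_bij; exact: enum_val_bij.
  by apply: eq_bigr => k _; rewrite !mxE ei mulr1; case: (enum_val k).
rewrite -(pair_bigA _ (fun s' a' => discount M * trans M s a s' * mu s' a')) /=.
under eq_bigr => s' _ do rewrite -mulr_sumr (proj2 (Hmu s')) mulr1.
by rewrite -mulr_sumr trans_sum1.
Qed.

(* The deflated family drives the differences of the deflated iteration. *)
Lemma deflated_step_subP (R : realType) (S A : finType) (M : mdp R S A)
    (d Q Q' : 'cV[R]_(npairs S A)) : prob_vector d ->
  exists2 mu : S -> A -> R, is_policy mu
    & deflated_coord d (deflated_step M d Q - deflated_step M d Q')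
      = deflated_map M d mu (deflated_coord d (Q - Q')).
Proof.
move=> Hd; have [mu Hmu E] := bellman_subP M Q Q'; exists mu => //.
have d1 := Hd.2; have A1 := policy_mx_ones M Hmu.
set x := Q - Q' in E *; set B := policy_mx M mu in E A1 *.
set g := discount M in A1 *.
have g1 : 1 - g != 0 by rewrite gt_eqF // subr_gt0 discount_lt1.
have step : deflated_step M d Q - deflated_step M d Q' =
    B *m x + (g / (1 - g) * (d^T *m (B *m x - x)) 0 0) *: ones R _.
  rewrite /deflated_step opprD addrACA E -scalerBl -mulrBr -/g.
  have -> : B *m x - x = (bellman M Q - Q) - (bellman M Q' - Q').
    by rewrite -E /x !opprD addrACA.
  by rewrite [d^T *m (_ - (_ - Q'))]mulmxBr [(_ - d^T *m (_ - Q')) _ _]mxE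
             [(- (d^T *m _)) _ _]mxE.
have Pi1 : oblique_proj d *m ones R _ = 0.
  by rewrite /oblique_proj mulmxBl mul1mx -mulmxA d1 mulmx1 subrr.
have PiE y : oblique_proj d *m y = y - (d^T *m y) 0 0 *: ones R _.
  rewrite /oblique_proj mulmxBl mul1mx -mulmxA.
  by rewrite [X in _ *m X]mx11_scalar mul_mx_scalar.
have Pid : oblique_proj d *m oblique_proj d = oblique_proj d.
  by rewrite {2}/oblique_proj mulmxBr mulmx1 mulmxA Pi1 mul0mx subr0.
have BPi : B *m (oblique_proj d *m x) = B *m x - (g * (d^T *m x) 0 0) *: ones R _.
  by rewrite PiE mulmxBr -scalemxAr A1 scalerA mulrC.
have dZ c : (d^T *m (c *: ones R _)) 0 0 = c.
  by rewrite -scalemxAr d1 !mxE eqxx mulr1.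
rewrite /deflated_map lfunE /= /deflated_fun /deflated_coord /=.
rewrite vsprojK; last exact: oblique_proj_annihv.
have dD y z : (d^T *m (y + z)) 0 0 = (d^T *m y) 0 0 + (d^T *m z) 0 0.
  by rewrite mulmxDr mxE.
have dN y : (d^T *m (- y)) 0 0 = - (d^T *m y) 0 0 by rewrite mulmxN mxE.
rewrite step; congr pair.
  rewrite -/B -/g -mulmxA BPi !(dD, dN) !dZ.
  by field.
apply: val_inj; rewrite /= vsprojK; last exact: oblique_proj_annihv.
have PiPi y : oblique_proj d *m (oblique_proj d *m y) = oblique_proj d *m y.
  by rewrite mulmxA Pid.
have PiD y c : oblique_proj d *m (y + c *: ones R _) = oblique_proj d *m y.
  by rewrite mulmxDr -scalemxAr Pi1 scaler0 addr0.
have vE : vsval (vsproj (annihv d) (oblique_proj d *m x)) = oblique_proj d *m x.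
  by rewrite vsprojK //; exact: oblique_proj_annihv.
rewrite PiD restr_mxE vE -!mulmxA PiPi; last exact: oblique_proj_annihv.
by rewrite BPi -scaleNr PiD.
Qed.

(* Main.v *)
Require Import Defs.
From HB Require Import structures.
From mathcomp Require Import all_boot all_order all_algebra.
From mathcomp Require Import boolp classical_sets reals topology normedtype.
From mathcomp Require Import sequences exp.
From mathcomp Require Import ring lra.

(** Everything is measured by one gauge on matrices: [q B] is the sum of the
absolute values of the entries of [Pi *m B], where [Pi] is the orthogonal
projection along the all-ones vector.

A policy matrix maps the all-ones vector to [gamma] times itself, and every
oblique projection [Pi_d] kills that vector. Hence [Pi_d B Pi_d = Pi_d B] for
every product [B] of policy matrices, and a product of sandwiched factors
[Pi_d A Pi_d] collapses to [Pi_d B]. Since [Pi_d Pi_e = Pi_d] for all [d] and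
[e], the sizes of [Pi_d B] and [Pi_e B] agree up to a constant. This removes
both [d] and the choice of the subspace from the problem.

A product of stochastic policy matrices is affine in each factor, and a policy
matrix is a convex combination of deterministic ones, so replacing the factors
one at a time by a worst deterministic policy bounds [q] by its value on a
deterministic product ([exists_deterministic_prod_ge]). Let [a k] be the
supremum of [q] over deterministic products of length [k]. The sandwich
identity makes [a] submultiplicative, so by a Fekete argument it has a rate [r]
with [r ^ k <= a k] and [a k <= C rho ^ k] for every [rho > r]
([submultiplicative_growth]). Products of policy matrices are nonnegative with
row sums [gamma ^ k], so [a k] is at most a constant times [gamma ^ k] and
[r <= gamma] ([exists_policy_growth_rate]).

It remains to see that each of the joint spectral radii is [r]. The block
triangular shape of the deflated maps makes a product of length [k + 1] a fixed
linear function of the single matrix [Y = A_k Pi_d A_(k-1) ... A_0], which can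
be read back, up to projections, from the lower-right block; the projected
family has the same form. Any submultiplicative norm is therefore bounded above
by a multiple of the entries of [Y], and below by a multiple of the entries of
[Pi_d A_k ... A_0]: the lower bound comes from multiplying by rank-one maps on
both sides ([snorm_functional_ge]) and needs no compactness. Constants disappear
under [k]-th roots, so these two bounds give convergence to [r]
([policy_family_jsr_cvg], [jsr_seq_cvg]). The extra factor between lengths [k]
and [k + 1], due to the upper-right block, costs only a constant as well. *)

Set Implicit Arguments.
Unset Strict Implicit.
Unset Printing Implicit Defensive.

Import Order.TTheory GRing.Theory Num.Theory.
Import numFieldNormedType.Exports.

Local Open Scope classical_set_scope.
Local Open Scope ring_scope.

(** * The entrywise l1 norm of matrices *)

Section EntryNorm.
Variable R : realType.

Definition entry_norm m n (B : 'M[R]_(m, n)) : R := \sum_i \sum_j `|B i j|.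

Lemma entry_norm_ge0 m n (B : 'M[R]_(m, n)) : 0 <= entry_norm B.
Proof. by rewrite sumr_ge0 // => i _; rewrite sumr_ge0. Qed.

Lemma entry_norm0 m n : entry_norm (0 : 'M[R]_(m, n)) = 0.
Proof.
rewrite /entry_norm big1 // => i _.
by rewrite big1 // => j _; rewrite mxE normr0.
Qed.

Lemma entry_normD m n (B C : 'M[R]_(m, n)) :
  entry_norm (B + C) <= entry_norm B + entry_norm C.
Proof.
rewrite -big_split ler_sum // => i _; rewrite -big_split ler_sum // => j _.
by rewrite mxE ler_normD.
Qed.

Lemma entry_normZ m n c (B : 'M[R]_(m, n)) :
  entry_norm (c *: B) = `|c| * entry_norm B.
Proof.
rewrite mulr_sumr; apply: eq_bigr => i _; rewrite mulr_sumr.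
by apply: eq_bigr => j _; rewrite mxE normrM.
Qed.

Lemma entry_norm_sum m n I (r : seq I) (P : pred I) (B : I -> 'M[R]_(m, n)) :
  entry_norm (\sum_(i <- r | P i) B i) <= \sum_(i <- r | P i) entry_norm (B i).
Proof.
elim/big_rec2: _ => [|i x y _ le]; first by rewrite entry_norm0.
by rewrite (le_trans (entry_normD _ _)) // lerD2l.
Qed.

Lemma entry_normM m n p (B : 'M[R]_(m, n)) (C : 'M[R]_(n, p)) :
  entry_norm (B *m C) <= entry_norm B * entry_norm C.
Proof.
rewrite /entry_norm mulr_suml ler_sum // => i _.
(* The product of norms sums over pairs (l, l'), the norm of the product only
   over the diagonal l' = l. *)
have -> : (\sum_j `|B i j|) * (\sum_l \sum_j `|C l j|) =
   \sum_l \sum_l' \sum_j `|B i l| * `|C l' j|.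
  rewrite mulr_suml; apply: eq_bigr => l _; rewrite mulr_sumr.
  by apply: eq_bigr => l' _; rewrite mulr_sumr.
apply: (@le_trans _ _ (\sum_l \sum_j `|B i l| * `|C l j|)).
  rewrite [leRHS]exchange_big ler_sum // => j _; rewrite mxE.
  rewrite (le_trans (ler_norm_sum _ _ _)) // ler_sum // => l _.
  by rewrite normrM.
rewrite ler_sum // => l _; rewrite [leRHS](bigD1 l) //= lerDl.
by rewrite sumr_ge0 // => l' _; rewrite sumr_ge0 // => j _; rewrite mulr_ge0.
Qed.

End EntryNorm.

(** * Comparing a submultiplicative norm with matrix entries *)

Section SubmultNorm.
Variables (R : realType) (V : vectType R) (N : submult_norm V).

Lemma snorm0 : N 0 = 0.
Proof. by rewrite -(scale0r 0) snormZ normr0 mul0r. Qed.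

Lemma snorm_sum I (r : seq I) (P : pred I) (f : I -> 'End(V)) :
  N (\sum_(i <- r | P i) f i) <= \sum_(i <- r | P i) N (f i).
Proof.
elim/big_rec2: _ => [|i x y _ le]; first by rewrite snorm0.
by rewrite (le_trans (snormD _ _ _)) // lerD2l.
Qed.

Lemma snorm_linear_le n (L : 'M[R]_n -> 'End(V)) : linear L ->
  exists2 C, 0 < C & forall B, N (L B) <= C * entry_norm B.
Proof.
move=> linL.
pose L' : {linear 'M[R]_n -> 'End(V)} :=
  HB.pack L (GRing.isLinear.Build _ _ _ _ L linL).
pose D := \sum_i \sum_j N (L (delta_mx i j)).
have D0 : 0 <= D.
  by rewrite sumr_ge0 // => i _; rewrite sumr_ge0 // => j _; apply: snorm_ge0.
exists (D + 1) => [|B]; first by rewrite ltr_wpDl.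
have -> : L B = \sum_i \sum_j B i j *: L (delta_mx i j).
  rewrite -[L]/(L' : _ -> _) {1}[B]matrix_sum_delta linear_sum.
  apply: eq_bigr => i _; rewrite linear_sum; apply: eq_bigr => j _.
  by rewrite linearZ.
rewrite (le_trans (snorm_sum _ _ _)) // mulr_sumr ler_sum // => i _.
rewrite (le_trans (snorm_sum _ _ _)) // mulr_sumr ler_sum // => j _.
rewrite snormZ mulrC ler_wpM2r // ler_wpDr //.
rewrite /D (bigD1 i) //= (bigD1 j) //= -addrA lerDl addr_ge0 //.
  by rewrite sumr_ge0 // => l _; apply: snorm_ge0.
by rewrite sumr_ge0 // => l _; rewrite sumr_ge0 // => ? _; apply: snorm_ge0.
Qed.

(** For the rank-one map [g x = phi x *: v] one has [g f g = phi (f v) *: g], so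
[`|phi (f v)| * N g <= N g * N f * N g]; dividing by [N g] bounds a matrix
coefficient of [f] by [N f]. This replaces the equivalence of norms in finite
dimension. *)
Lemma snorm_functional_ge (phi : {linear V -> R^o}) (v : V) (f : 'End(V)) :
  `|phi (f v)| <= N (linfun (fun x => phi x *: v)) * N f.
Proof.
have lin : linear (fun x => phi x *: v).
  by move=> c x y; rewrite linearP scalerDl scalerA.
pose g0 : {linear V -> V} :=
  HB.pack (fun x => phi x *: v) (GRing.isLinear.Build _ _ _ _ _ lin).
rewrite -[fun x => phi x *: v]/(g0 : _ -> _); set g := linfun g0.
have gE x : g x = phi x *: v by rewrite lfunE.
have [g_0|gn0] := eqVneq g 0.
  suff -> : phi (f v) = 0 by rewrite normr0 mulr_ge0 ?snorm_ge0.
  have [->|vn0] := eqVneq v 0; first by rewrite !linear0.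
  move/lfunP: g_0 => /(_ (f v)); rewrite gE lfunE /= => /eqP.
  by rewrite scaler_eq0 (negPf vn0) orbF => /eqP.
have gfg : (g \o (f \o g))%VF = phi (f v) *: g.
  apply/lfunP => x; rewrite scale_lfunE !comp_lfunE !gE linearZ linearZ /=.
  by rewrite scalerA mulrC.
have Ng : 0 < N g.
  rewrite lt_neqAle snorm_ge0 andbT eq_sym; apply: contra_neq gn0.
  exact: snorm_eq0.
rewrite -(ler_pM2r Ng) -snormZ -gfg (le_trans (snormM _ _ _)) //.
by rewrite -mulrA ler_pM2l // snormM.
Qed.

End SubmultNorm.

(** The lower counterpart of [snorm_linear_le], for a matrix [B] that can be
read off from [f] through fixed maps [phi] and [psi]. *)
Lemma snorm_entries_ge (R : realType) (V : vectType R) (N : submult_norm V) n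
    (phi : {linear V -> 'cV[R]_n}) (psi : 'cV[R]_n -> V) :
  exists2 C, 0 < C & forall (f : 'End(V)) (B : 'M[R]_n),
    (forall x, phi (f (psi x)) = B *m x) -> entry_norm B <= C * N f.
Proof.
have lin i : linear (fun x => phi x i 0 : R^o).
  by move=> c x y; rewrite linearP !mxE.
pose coord i : {linear V -> R^o} :=
  HB.pack (fun x => phi x i 0 : R^o) (GRing.isLinear.Build _ _ _ _ _ (lin i)).
pose D i j := N (linfun (fun x => coord i x *: psi (delta_mx j 0))).
exists (\sum_i \sum_j D i j + 1) => [|f B Bf].
  rewrite ltr_wpDl // sumr_ge0 // => i _; rewrite sumr_ge0 // => j _.
  exact: snorm_ge0.
rewrite mulrDl mul1r -[leLHS]addr0 lerD ?snorm_ge0 // mulr_suml ler_sum // => i _.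
rewrite mulr_suml ler_sum // => j _.
have -> : B i j = coord i (f (psi (delta_mx j 0))).
  by rewrite /= Bf -colE mxE.
exact: snorm_functional_ge.
Qed.

Lemma restr_mx_linear (R : realType) n (U : {vspace 'cV[R]_n}) :
  linear (@restr_mx R n U).
Proof.
move=> c B C; apply/lfunP => x; rewrite add_lfunE scale_lfunE !lfunE /=.
by rewrite mulmxDl -scalemxAl linearP.
Qed.

(** * Growth rates and joint spectral radii *)

Lemma root_const_cvg1 (R : realType) (c : R) : 0 < c ->
  c `^ (k%:R^-1) @[k --> \oo] --> (1 : R).
Proof.
move=> c0; have cv : k%:R^-1 * ln c @[k --> \oo] --> (0 : R).
  rewrite -(mul0r (ln c)); apply: cvgMr_tmp.
  by rewrite -(cvg_shiftS (fun k => k%:R^-1 : R)); apply: cvg_harmonic.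
under eq_fun => k do rewrite /powR gt_eqF //.
by have := cvg_comp _ _ cv (@continuous_expR R 0); rewrite expR0.
Qed.

Lemma root_scaled_exprn (R : realType) (C r : R) k : (0 < k)%N ->
  0 <= C -> 0 <= r -> (C * r ^+ k) `^ (k%:R^-1) = C `^ (k%:R^-1) * r.
Proof.
move=> k0 C0 r0; rewrite powRM ?exprn_ge0 // -powR_mulrn // -powRrM.
by rewrite divff ?powRr1 // pnatr_eq0 -lt0n.
Qed.

Lemma root_le (R : realType) (x y : R) k : 0 <= x -> x <= y ->
  x `^ (k%:R^-1) <= y `^ (k%:R^-1).
Proof.
by move=> x0 xy; rewrite ge0_ler_powR ?nnegrE ?invr_ge0 // (le_trans x0).
Qed.

Lemma le_growth_rate (R : realType) (r g C : R) : 0 <= r -> 0 <= g -> 0 < C ->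
  (forall k, (0 < k)%N -> r ^+ k <= C * g ^+ k) -> r <= g.
Proof.
move=> r0 g0 C0 le.
have cv : C `^ (k%:R^-1) * g @[k --> \oo] --> g.
  by rewrite -[X in _ --> X]mul1r; apply: cvgMr_tmp; apply: root_const_cvg1.
rewrite -(cvg_lim (@Rhausdorff _) cv); apply: limr_ge.
  by apply/cvg_ex; exists g.
near=> k; have k0 : (0 < k)%N by near: k; exists 1%N.
have := root_le k (exprn_ge0 k r0) (le k k0).
rewrite root_scaled_exprn ?(ltW C0) // -[r ^+ k]mul1r root_scaled_exprn //.
by rewrite powR1 mul1r.
Unshelve. all: by end_near. Qed.

(** Fekete's lemma, in the form of two exponential bounds. The rate is the
infimum of the [x] such that [a m <= x ^+ m] for some positive [m]; each such
[x] controls all of [a] by Euclidean division of the index by [m], and the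
[k]-th root of [a k] is itself such an [x]. *)
Lemma submultiplicative_growth (R : realType) (a : nat -> R) :
  (forall k, 0 <= a k) -> (forall k m, a (k + m)%N <= a k * a m) ->
  exists r, [/\ 0 <= r, (forall k, (0 < k)%N -> r ^+ k <= a k)
    & forall rho, r < rho -> exists2 C, 0 < C & forall k, a k <= C * rho ^+ k].
Proof.
move=> a0 aM.
pose X := [set x : R | 0 <= x /\ exists2 m, (0 < m)%N & a m <= x ^+ m].
have X0 : X !=set0 by exists (a 1%N); split=> //; exists 1%N.
have Xlb : has_lbound X by exists 0 => x [].
exists (inf X); split.
- by apply: lb_le_inf => // x [].
- move=> k k0; pose x := a k `^ k%:R^-1.
  have xk : x ^+ k = a k.
    rewrite -powR_mulrn ?powR_ge0 // -powRrM mulVf ?powRr1 //.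
    by rewrite pnatr_eq0 -lt0n.
  rewrite -xk lerXn2r ?nnegrE ?powR_ge0 //; first by apply: lb_le_inf => // y [].
  by apply: ge_inf => //; split; [exact: powR_ge0 | exists k; rewrite ?xk].
move=> rho /(inf_lt X0)[x [x0 [m m0 am]] xrho].
have rho0 : 0 < rho by exact: le_lt_trans x0 xrho.
have arho : a m <= rho ^+ m.
  by rewrite (le_trans am) // lerXn2r ?nnegrE // ltW.
(* [c s] is the constant lost on a remainder s < m. *)
pose c s := a s / rho ^+ s.
have c0 s : 0 <= c s by rewrite divr_ge0 // exprn_ge0 // ltW.
have aq q s : a (q * m + s)%N <= rho ^+ (q * m) * a s.
  elim: q => [|q IH]; first by rewrite mul0n add0n expr0 mul1r.
  rewrite mulSn -addnA exprD -mulrA (le_trans (aM _ _)) //.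
  by rewrite ler_pM.
exists (\sum_(s < m) c s + 1) => [|k]; first by rewrite ltr_wpDl // sumr_ge0.
rewrite [in a k](divn_eq k m) (le_trans (aq _ _)) //.
have -> : a (k %% m)%N = c (k %% m)%N * rho ^+ (k %% m).
  by rewrite divfK // gt_eqF // exprn_gt0.
rewrite mulrCA -exprD -divn_eq ler_wpM2r ?exprn_ge0 // ?ltW //.
rewrite (bigD1 (Ordinal (ltn_pmod k m0))) //= -addrA ltr_pwDr //.
by rewrite ltr_wpDl // sumr_ge0.
Qed.

(** Multiplicative constants disappear under [k]-th roots, so exponential bounds
on products identify the joint spectral radius. The lower bound asks for a
single product at the exact rate, the upper bound for all products at every
larger rate: this is what Fekete's lemma provides. *)
Lemma jsr_seq_cvg (R : realType) (V : vectType R) (N : submult_norm V)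
    (T : Type) (F : T -> 'End(V)) (P : set T) (r : R) : 0 <= r ->
  (exists2 c, 0 < c & forall k, (0 < k)%N -> exists2 x : nat -> T,
     (forall i, P (x i)) & c * r ^+ k <= N (iter_comp (F \o x) k)) ->
  (forall rho, r < rho -> exists2 C, 0 < C & forall k (x : nat -> T),
     (0 < k)%N -> (forall i, P (x i)) ->
     N (iter_comp (F \o x) k) <= C * rho ^+ k) ->
  jsr_seq N [set F x | x in P] @ \oo --> r.
Proof.
move=> r0 [c c0 lower] upper.
have [x0 Px0 _] := lower 1%N isT.
have eq_iter A B k : (forall i, (i < k)%N -> A i = B i) ->
    iter_comp A k = iter_comp B k :> 'End(V).
  elim: k => //= k IH e; rewrite e // IH // => i ik.
  by apply: e; rewrite ltnS ltnW.
have ubd rho : r < rho -> exists2 C, 0 < C & forall k, (0 < k)%N ->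
    ubound [set N (iter_comp A k) `^ (k%:R^-1) | A in
      [set A | forall i, (i < k)%N -> [set F x | x in P] (A i)]]
     (C `^ (k%:R^-1) * rho).
  move=> rrho; have [C C0 leC] := upper _ rrho; exists C => // k k0.
  move=> _ [A HA <-].
  have /choice[x Hx] : forall i, exists x, P x /\ ((i < k)%N -> A i = F x).
    move=> i; case: (ltnP i k) => [/HA[x Px <-]|_]; first by exists x.
    by exists (x0 0%N).
  (* [jsr_seq] constrains only the first k factors; x0 fills in the others. *)
  rewrite (eq_iter A (F \o x)); last by move=> i /(Hx i).2.
  have rho0 : 0 <= rho by rewrite (le_trans r0) // ltW.
  rewrite -root_scaled_exprn ?(ltW C0) // root_le ?snorm_ge0 //.
  by apply: leC => // i; case: (Hx i).
have lbd k : (0 < k)%N -> c `^ (k%:R^-1) * r <= jsr_seq N [set F x | x in P] k.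
  move=> k0; have [x Px le] := lower k k0.
  (* Any rate above r gives the upper bound that makes [sup] meaningful. *)
  have [C _ /(_ k k0) hub] := ubd (r + 1) (ltr_pwDr ltr01 (lexx r)).
  apply: (@le_trans _ _ (N (iter_comp (F \o x) k) `^ (k%:R^-1))).
    by rewrite -root_scaled_exprn ?(ltW c0) // root_le // mulr_ge0 ?exprn_ge0 // ltW.
  apply: ub_le_sup; first by eexists; exact: hub.
  by exists (F \o x) => // i _; exists (x i).
apply/cvgrPdist_lt => e e0.
have e20 : 0 < e / 2 by rewrite divr_gt0.
have [C C0 hub] := ubd (r + e / 2) (ltr_pwDr e20 (lexx r)).
have cvc : c `^ (k%:R^-1) * r @[k --> \oo] --> r.
  by rewrite -[X in _ --> X]mul1r; apply: cvgMr_tmp; apply: root_const_cvg1.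
have cvC : C `^ (k%:R^-1) * (r + e / 2) @[k --> \oo] --> r + e / 2.
  by rewrite -[X in _ --> X]mul1r; apply: cvgMr_tmp; apply: root_const_cvg1.
near=> k; have k0 : (0 < k)%N by near: k; exists 1%N.
have lo := lbd k k0.
have hi : jsr_seq N [set F x | x in P] k <= C `^ (k%:R^-1) * (r + e / 2).
  apply: ge_sup; last exact: hub.
  exists (N (iter_comp (F \o x0) k) `^ (k%:R^-1)), (F \o x0) => // i _.
  by exists (x0 i).
have : r - e < c `^ (k%:R^-1) * r.
  by near: k; apply: (cvgr_gt _ cvc); rewrite gtrBl.
have : C `^ (k%:R^-1) * (r + e / 2) < r + e.
  by near: k; apply: (cvgr_lt _ cvC); rewrite ltrD2l; lra.
move=> h1 h2; rewrite ltr_distlC; apply/andP; split; lra.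
Unshelve. all: by end_near. Qed.

(** * Oblique projections along the all-ones vector *)

Section Projection.
Variables (R : realType) (n : nat).
Implicit Types (d e : 'cV[R]_n) (B : 'M[R]_n).

Lemma oblique_proj_ones d : prob_vector d -> oblique_proj d *m ones R n = 0.
Proof.
by move=> [_ d1]; rewrite /oblique_proj mulmxBl mul1mx -mulmxA d1 mulmx1 subrr.
Qed.

Lemma oblique_projK d e : prob_vector d ->
  oblique_proj d *m oblique_proj e = oblique_proj d.
Proof.
move=> d1; rewrite [oblique_proj e]/oblique_proj mulmxBr mulmx1 mulmxA.
by rewrite oblique_proj_ones // mul0mx subr0.
Qed.

(** [oblique_proj e] differs from the identity by a matrix whose columns are
multiples of [ones]; [B] preserves this line and [oblique_proj d] kills it. *)
Lemma oblique_proj_sandwich d e B c : prob_vector d ->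
  B *m ones R n = c *: ones R n ->
  oblique_proj d *m B *m oblique_proj e = oblique_proj d *m B.
Proof.
move=> d1 B1; rewrite [oblique_proj e]/oblique_proj mulmxBr mulmx1 mulmxA.
by rewrite -(mulmxA _ B) B1 -scalemxAr oblique_proj_ones // scaler0 mul0mx subr0.
Qed.

Lemma oblique_proj_id d x : x \in annihv d -> oblique_proj d *m x = x.
Proof.
rewrite annihvP => /eqP dx.
by rewrite /oblique_proj mulmxBl mul1mx -mulmxA dx mulmx0 subr0.
Qed.

Lemma entry_norm_row_sums B c : (forall i j, 0 <= B i j) ->
  B *m ones R n = c *: ones R n -> entry_norm B = n%:R * c.
Proof.
move=> B0 /matrixP B1; transitivity (\sum_(i < n) c).
  apply: eq_bigr => i _; have := B1 i 0; rewrite !mxE mulr1 => <-.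
  by apply: eq_bigr => j _; rewrite mxE mulr1 ger0_norm.
by rewrite sumr_const card_ord mulr_natl.
Qed.

End Projection.

(** * Products of policy matrices *)

Section PolicyProducts.
Variables (R : realType) (S A : finType) (M : mdp R S A).
Local Notation n := (npairs S A).
Local Notation g := (discount M).
Implicit Types (mu : nat -> S -> A -> R) (pi : nat -> S -> A).

Fixpoint policy_prod mu k : 'M[R]_n :=
  if k is k'.+1 then policy_mx M (mu k') *m policy_prod mu k' else 1%:M.

Lemma one_hot_policy (p : S -> A) : is_policy (one_hot R p).
Proof.
move=> s; split=> [a|]; first exact: ler0n.
by rewrite (bigD1 (p s)) //= big1 ?addr0 /one_hot ?eqxx // => a /negPf->.
Qed.

Lemma policy_prod_ones mu k : (forall i, is_policy (mu i)) ->
  policy_prod mu k *m ones R n = g ^+ k *: ones R n.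
Proof.
move=> Hmu; elim: k => [|k IH] /=; first by rewrite mul1mx scale1r.
by rewrite -mulmxA IH -scalemxAr policy_mx_ones // scalerA -exprSr.
Qed.

Lemma policy_mx_ge0 (mu : S -> A -> R) i j : is_policy mu ->
  0 <= policy_mx M mu i j.
Proof.
move=> Hmu; rewrite mxE; case: (enum_val i) => s a; case: (enum_val j) => s' a'.
by rewrite !mulr_ge0 ?trans_ge0 ?(Hmu s').1 // ltW // discount_gt0.
Qed.

Lemma policy_prod_ge0 mu k i j : (forall i, is_policy (mu i)) ->
  0 <= policy_prod mu k i j.
Proof.
move=> Hmu; elim: k i j => [|k IH] i j /=; first by rewrite mxE ler0n.
by rewrite mxE sumr_ge0 // => l _; rewrite mulr_ge0 // policy_mx_ge0.
Qed.

Lemma entry_norm_policy_mx (mu : S -> A -> R) : is_policy mu ->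
  entry_norm (policy_mx M mu) = n%:R * g.
Proof.
move=> Hmu; apply: entry_norm_row_sums => [i j|]; first exact: policy_mx_ge0.
exact: policy_mx_ones.
Qed.

Lemma entry_norm_policy_prod mu k : (forall i, is_policy (mu i)) ->
  entry_norm (policy_prod mu k) = n%:R * g ^+ k.
Proof.
move=> Hmu; apply: entry_norm_row_sums => [i j|]; first exact: policy_prod_ge0.
exact: policy_prod_ones.
Qed.

Lemma policy_prodD mu k m : policy_prod mu (k + m) =
  policy_prod (fun i => mu (i + m)%N) k *m policy_prod mu m.
Proof. by elim: k => [|k IH] /=; rewrite ?mul1mx // IH mulmxA. Qed.

Lemma eq_policy_prod mu mu' k : (forall i, (i < k)%N -> mu i = mu' i) ->
  policy_prod mu k = policy_prod mu' k.
Proof.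
elim: k => //= k IH e; rewrite e // IH // => i ik.
by apply: e; rewrite ltnS ltnW.
Qed.

(** The weight of a deterministic policy [p] is its probability when the actions
of all states are drawn independently from [mu]; its marginals are [mu]. *)
Lemma policy_mx_convex (mu : S -> A -> R) : is_policy mu ->
  exists w : {ffun S -> A} -> R,
    [/\ forall p, 0 <= w p, \sum_p w p = 1
      & policy_mx M mu = \sum_p w p *: policy_mx M (one_hot R p)].
Proof.
move=> Hmu; pose w (p : {ffun S -> A}) := \prod_s mu s (p s); exists w.
split=> [p||]; first by apply: prodr_ge0 => s _; exact: (Hmu s).1.
  rewrite -(bigA_distr_bigA (fun s a => mu s a)) /= big1 // => s _.
  exact: (Hmu s).2.
apply/matrixP => i j; rewrite summxE mxE.
under [RHS]eq_bigr => p _ do rewrite mxE mxE.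
case: (enum_val i) => s a; case: (enum_val j) => s' a'.
under [RHS]eq_bigr => p _ do rewrite mulrCA.
rewrite -mulr_sumr; congr (_ * _).
(* The marginal of the product weight at (s', a'), as a product over states. *)
pose F t b := if t == s' then mu t b * (a' == b)%:R else mu t b.
transitivity (\prod_t \sum_b F t b).
  rewrite (bigD1 s') //= [X in _ * X]big1 ?mulr1.
    rewrite /F eqxx (bigD1 a') //= eqxx mulr1 big1 ?addr0 // => b.
    by rewrite eq_sym => /negPf->; rewrite mulr0.
  by move=> t /negPf ts; rewrite /F ts; exact: (Hmu t).2.
rewrite bigA_distr_bigA; apply: eq_bigr => p _.
rewrite /w /one_hot (bigD1 s') //= [in RHS](bigD1 s') //= /F eqxx.
rewrite -!mulrA; congr (_ * _); rewrite mulrC; congr (_ * _).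
by apply: eq_bigr => t /negPf->.
Qed.

(** A convex function on a polytope attains its maximum at a vertex. *)
Lemma exists_deterministic_mx_ge k m (X : 'M[R]_(k, n)) (Z : 'M[R]_(n, m))
    (mu : S -> A -> R) : is_policy mu ->
  exists p : S -> A, entry_norm (X *m policy_mx M mu *m Z)
                     <= entry_norm (X *m policy_mx M (one_hot R p) *m Z).
Proof.
move=> /policy_mx_convex[w [w0 w1 ->]].
pose f (p : {ffun S -> A}) := entry_norm (X *m policy_mx M (one_hot R p) *m Z).
case: (@arg_maxP _ _ _ [ffun=> action0 M] xpredT f isT) => p _ pmax.
exists p; rewrite mulmx_sumr mulmx_suml (le_trans (entry_norm_sum _ _ _)) //.
rewrite -[leRHS]mul1r -w1 mulr_suml ler_sum // => q _.
rewrite -scalemxAr -scalemxAl entry_normZ ger0_norm // ler_wpM2l //.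
exact: pmax.
Qed.

Lemma exists_deterministic_prod_ge k m (X : 'M[R]_(m, n)) mu :
  (forall i, is_policy (mu i)) ->
  exists pi, entry_norm (X *m policy_prod mu k)
             <= entry_norm (X *m policy_prod (fun i => one_hot R (pi i)) k).
Proof.
move=> Hmu; elim: k m X => [|k IH] m X /=.
  by exists (fun=> fun=> action0 M).
have [pi le1] := IH _ (X *m policy_mx M (mu k)).
have [p le2] := exists_deterministic_mx_ge X
  (policy_prod (fun i => one_hot R (pi i)) k) (Hmu k).
exists (fun i => if i == k then p else pi i); rewrite eqxx !mulmxA.
rewrite (le_trans le1) // (le_trans le2) //.
rewrite (@eq_policy_prod _ (fun i => one_hot R (pi i))) // => i ik.
by rewrite ltn_eqF.
Qed.

(** [r] is the exponential growth rate of the gauge over products of policy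
matrices. The lower bound already holds for deterministic policies and the upper
one for all stochastic policies, so every intermediate family has this rate. The
factor 2 lets a product close to the supremum serve as a witness. *)
Definition policy_growth_rate (r : R) : Prop :=
  [/\ 0 <= r,
    forall k, (0 < k)%N -> exists pi, r ^+ k / 2 <= entry_norm
      (perp_proj R n *m policy_prod (fun i => one_hot R (pi i)) k)
  & forall rho, r < rho -> exists2 C, 0 < C & forall k mu,
      (forall i, is_policy (mu i)) ->
      entry_norm (perp_proj R n *m policy_prod mu k) <= C * rho ^+ k].

Lemma exists_policy_growth_rate : exists2 r, policy_growth_rate r & r <= g.
Proof.
pose Pi := perp_proj R n.
pose q mu k := entry_norm (Pi *m policy_prod mu k).
pose X k := [set q (fun i => one_hot R (pi i)) k | pi in setT].
pose a k := sup (X k).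
have oh pi i : is_policy (one_hot R (pi i)) by exact: one_hot_policy.
have g0 : 0 < g := discount_gt0 M.
pose K := entry_norm Pi * n%:R + 1.
have K0 : 0 < K by rewrite ltr_wpDl // mulr_ge0 // entry_norm_ge0.
have qK mu k : (forall i, is_policy (mu i)) -> q mu k <= K * g ^+ k.
  move=> Hmu; rewrite /q (le_trans (entry_normM _ _)) //.
  rewrite entry_norm_policy_prod // mulrA ler_wpM2r ?exprn_ge0 // ?lerDl //.
  exact: ltW.
have ubX k : ubound (X k) (K * g ^+ k) by move=> _ [pi _ <-]; apply: qK => i.
have X0 k : X k !=set0 by eexists; exists (fun=> fun=> action0 M).
have qa mu k : (forall i, is_policy (mu i)) -> q mu k <= a k.
  move=> Hmu; have [pi le] := exists_deterministic_prod_ge k Pi Hmu.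
  apply: le_trans le _; apply: ub_le_sup; first by eexists; exact: ubX.
  by exists pi.
have a0 k : 0 <= a k.
  exact: le_trans (entry_norm_ge0 _) (qa _ k (oh (fun=> fun=> action0 M))).
have aM k m : a (k + m)%N <= a k * a m.
  apply: ge_sup => // _ [pi _ <-]; rewrite /q policy_prodD.
  set B := policy_prod _ k; set C := policy_prod _ m.
  have U := uniform_vector_prob M.
  have -> : Pi *m (B *m C) = (Pi *m B) *m (Pi *m C).
    have B1 : B *m ones R n = g ^+ k *: ones R n by apply: policy_prod_ones.
    rewrite /Pi -oblique_proj_uniform [RHS]mulmxA.
    by rewrite (oblique_proj_sandwich _ U B1) mulmxA.
  rewrite (le_trans (entry_normM _ _)) // ler_pM ?entry_norm_ge0 //.
  - by apply: qa => i; exact: one_hot_policy.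
  - exact: qa.
have [r [r0 lo up]] := submultiplicative_growth a0 aM.
exists r; last first.
  apply: (le_growth_rate r0 (ltW g0) K0) => k k0.
  by rewrite (le_trans (lo k k0)) //; apply: ge_sup.
split=> //.
- (* If a k > 0, some product exceeds a k / 2; if a k = 0, any product will do. *)
  move=> k k0; have [ak0|ak0] := eqVneq (a k) 0.
    exists (fun=> fun=> action0 M); apply: le_trans (entry_norm_ge0 _).
    by have := lo k k0; rewrite ak0; lra.
  have : a k / 2 < sup (X k).
    by have := a0 k; rewrite le_eqVlt eq_sym (negPf ak0) /= -/(a k); lra.
  move=> /(sup_gt (X0 k))[_ [pi _ <-] lt]; exists pi.
  by apply: le_trans (ltW lt); have := lo k k0; lra.
- move=> rho /up[C C0 leC]; exists C => // k mu Hmu.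
  exact: le_trans (qa _ _ Hmu) (leC k).
Qed.

(** * Joint spectral radii of families built from policy matrices *)

Implicit Types d : 'cV[R]_n.

(** Common form of the projected and deflated families. A product of [k + 1]
maps is the linear function [L] of the matrix [A_k Pi_d A_(k-1) ... A_0], and
[phi] and [psi] recover from it the compression by [Pi_d]. The last factor is
kept outside the projection because the upper-right block of a deflated map
sees [A_k] itself and not [Pi_d A_k]. *)
Lemma policy_family_jsr_cvg d (V : vectType R) (N : submult_norm V)
    (L : 'M[R]_n -> 'End(V)) (phi : {linear V -> 'cV[R]_n})
    (psi : 'cV[R]_n -> V) (T : Type) (F : T -> 'End(V)) (P : set T)
    (tmu : T -> S -> A -> R) (r : R) :
  prob_vector d -> policy_growth_rate r -> linear L ->
  (forall Y x, phi (L Y (psi x)) = oblique_proj d *m Y *m oblique_proj d *m x) ->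
  (forall t, P t -> is_policy (tmu t)) ->
  (forall p : S -> A, exists2 t, P t & tmu t = one_hot R p) ->
  (forall x : nat -> T, (forall i, P (x i)) -> forall k,
     iter_comp (F \o x) k.+1
     = L (policy_mx M (tmu (x k)) *m oblique_proj d *m policy_prod (tmu \o x) k)) ->
  jsr_seq N [set F t | t in P] @ \oo --> r.
Proof.
move=> d1 [r0 lower upper] linL phiL Ppol Phot iterE.
have u1 := uniform_vector_prob M.
have [K K0 LK] := snorm_linear_le N linL.
have [C C0 NC] := snorm_entries_ge N phi psi.
pose Pi := perp_proj R n; pose Pd := oblique_proj d.
have PidK : Pi *m Pd = Pi by rewrite /Pi -oblique_proj_uniform oblique_projK.
have PdiK : Pd *m Pi = Pd by rewrite /Pi -oblique_proj_uniform oblique_projK.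
apply: jsr_seq_cvg => // [|rho rrho].
  pose E := entry_norm Pi * C + 1.
  have E0 : 0 < E by rewrite ltr_wpDl // mulr_ge0 ?entry_norm_ge0 // ltW.
  exists (2 * E)^-1 => [|[//|k] k0]; first by rewrite invr_gt0 mulr_gt0.
  have [pi rpi] := lower _ k0.
  have /choice[x Hx] i : exists t, P t /\ tmu t = one_hot R (pi i).
    by have [t] := Phot (pi i); exists t.
  have Px i : P (x i) by case: (Hx i).
  exists x => //; rewrite invfM mulrAC mulrC ler_pdivrMl // mulrC.
  apply: le_trans rpi _.
  have -> : (fun i => one_hot R (pi i)) = tmu \o x.
    by apply/funext => i /=; case: (Hx i).
  have Hpol i : is_policy ((tmu \o x) i) by exact: Ppol.
  have := policy_prod_ones k.+1 Hpol; set B := policy_prod _ k.+1 => B1.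
  set Nk := N _.
  (* [phi] and [psi] extract Pd A_k Pd A_(k-1) ... A_0 Pd, which is Pd *m B. *)
  have le : entry_norm (Pd *m B) <= C * Nk.
    apply: NC => y; rewrite iterE // phiL; congr (_ *m _).
    rewrite -(oblique_proj_sandwich d d1 B1); congr (_ *m _).
    rewrite /B /= !mulmxA; congr (_ *m _).
    exact: (oblique_proj_sandwich d d1 (policy_mx_ones M (Hpol k))).
  rewrite -/Pi -PidK -mulmxA (le_trans (entry_normM _ _)) //.
  rewrite (le_trans (ler_wpM2l (entry_norm_ge0 _) le)) // mulrA.
  by rewrite ler_wpM2r ?snorm_ge0 // lerDl.
have rho0 : 0 < rho by exact: le_lt_trans r0 rrho.
have [D D0 leD] := upper _ rrho.
pose G := K * (n%:R * discount M) * entry_norm Pd * D + 1.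
have g0 : 0 < discount M := discount_gt0 M.
exists (G / rho) => [|[//|k] x _ Px].
  rewrite divr_gt0 // ltr_wpDl //.
  by rewrite !mulr_ge0 ?entry_norm_ge0 // ltW.
have Hpol i : is_policy ((tmu \o x) i) by exact: Ppol.
rewrite iterE // exprS mulrA divfK ?gt_eqF // (le_trans (LK _)) //.
rewrite -/Pd; set Y := _ *m _.
have leY : entry_norm Y <= n%:R * discount M * (entry_norm Pd * (D * rho ^+ k)).
  have -> : Y = policy_mx M (tmu (x k)) *m (Pd *m (Pi *m policy_prod (tmu \o x) k)).
    by rewrite [Pd *m _]mulmxA PdiK mulmxA.
  rewrite (le_trans (entry_normM _ _)) // (entry_norm_policy_mx (Hpol k)).
  rewrite ler_wpM2l ?mulr_ge0 ?ler0n ?(ltW g0) //.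
  rewrite (le_trans (entry_normM _ _)) // ler_wpM2l ?entry_norm_ge0 //.
  exact: leD.
have -> : G * rho ^+ k =
    K * (n%:R * discount M * (entry_norm Pd * (D * rho ^+ k))) + rho ^+ k.
  by rewrite /G; ring.
by rewrite ler_wpDr ?exprn_ge0 ?(ltW rho0) // ler_pM2l.
Qed.

(** The inner projections of the product disappear by [oblique_proj_sandwich].
[U] is only assumed to have the elements of [annihv d], since the orthogonal
complement of [ones] and [annihv (uniform_vector R n)] are equal but not
convertible. *)
Lemma iter_comp_restr d (U : {vspace 'cV[R]_n}) mu k (x : subvs_of U) :
  prob_vector d -> U =i annihv d -> (forall i, is_policy (mu i)) ->
  vsval (iter_comp (fun i => restr_mx U
           (oblique_proj d *m policy_mx M (mu i) *m oblique_proj d)) k x)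
  = oblique_proj d *m policy_prod mu k *m vsval x.
Proof.
move=> d1 Ud Hmu; elim: k => [|k IH] /=.
  by rewrite id_lfunE mulmx1 oblique_proj_id // -Ud subvsP.
rewrite comp_lfunE restr_mxE; last first.
  by rewrite Ud -!mulmxA oblique_proj_annihv.
rewrite IH !mulmxA -[_ *m oblique_proj d *m oblique_proj d]mulmxA.
rewrite oblique_projK // (oblique_proj_sandwich d d1 (policy_mx_ones M (Hmu k))).
by [].
Qed.

Lemma projected_jsr_cvg (N : submult_norm (subvs_of (annihv (ones R n)))) r :
  policy_growth_rate r -> jsr_seq N (projected_family M) @ \oo --> r.
Proof.
move=> rr; have u1 := uniform_vector_prob M.
set U := annihv _ in N *; pose u := uniform_vector R n.
have Uu : U =i annihv u.
  move=> x; rewrite !annihvP /u /uniform_vector linearZ /= -scalemxAl.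
  rewrite scaler_eq0 invr_eq0 pnatr_eq0; suff /negPf-> : n != 0%N by [].
  by rewrite -lt0n; apply/card_gt0P; exists (state0 M, action0 M).
pose L (Y : 'M[R]_n) := restr_mx U (oblique_proj u *m Y).
have inU y : oblique_proj u *m y \in U by rewrite Uu oblique_proj_annihv.
apply: (@policy_family_jsr_cvg u _ N L (@vsval _ _ U)
  (fun x => vsproj U (oblique_proj u *m x)) _ (projected_map M) setT
  (@one_hot R S A) r) => //.
- by move=> c Y Z; rewrite /L mulmxDr -scalemxAr restr_mx_linear.
- by move=> Y x; rewrite /= restr_mxE vsprojK // -!mulmxA.
- by move=> t _; exact: one_hot_policy.
- by move=> p; exists p.
move=> x _ k; apply/lfunP => y; apply: val_inj; rewrite /= restr_mxE; last first.
  by rewrite -mulmxA.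
rewrite -[LHS]/(vsval (iter_comp (projected_map M \o x) k.+1 y)).
have -> : projected_map M \o x = fun i => restr_mx U
   (oblique_proj u *m policy_mx M (one_hot R (x i)) *m oblique_proj u).
  by rewrite /u oblique_proj_uniform.
have Hpol i : is_policy (one_hot R (x i)) by exact: one_hot_policy.
rewrite (iter_comp_restr (mu := fun i => one_hot R (x i)) _ _ u1 Uu) //=.
rewrite !mulmxA; congr (_ *m _ *m _).
by rewrite (oblique_proj_sandwich u u1 (policy_mx_ones M (Hpol k))).
Qed.

(** The deflated block matrix with an arbitrary matrix in place of the policy
matrix: since [Y] need not come from a single policy, this also expresses the
products of deflated maps. The projection on the right is omitted, being the
identity on [annihv d]. *)
Definition deflated_op_fun d (Y : 'M[R]_n) (p : deflated_space R d) :
    deflated_space R d :=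
  ((1 - discount M)^-1 * (d^T *m Y *m vsval p.2) 0 0,
   restr_mx (annihv d) (oblique_proj d *m Y) p.2).

Fact deflated_op_fun_linear d (Y : 'M[R]_n) : linear (@deflated_op_fun d Y).
Proof.
move=> c p q; rewrite /deflated_op_fun; congr pair => /=; last by rewrite linearP.
by rewrite mulmxDr -scalemxAr !mxE /GRing.scale /= mulrDr mulrCA.
Qed.

HB.instance Definition _ d (Y : 'M[R]_n) := GRing.isLinear.Build R
  (deflated_space R d) (deflated_space R d) _ (@deflated_op_fun d Y)
  (@deflated_op_fun_linear d Y).

Definition deflated_op d (Y : 'M[R]_n) : 'End(deflated_space R d) :=
  linfun (@deflated_op_fun d Y).

Lemma deflated_op_linear d : linear (@deflated_op d).
Proof.
move=> c Y Z; apply/lfunP => p; rewrite add_lfunE scale_lfunE !lfunE /=.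
rewrite /deflated_op_fun [oblique_proj d *m _]mulmxDr -scalemxAr restr_mx_linear.
congr pair; last by rewrite add_lfunE scale_lfunE.
by rewrite mulmxDr mulmxDl -scalemxAr -scalemxAl !mxE /= mulrDr mulrCA.
Qed.

Lemma deflated_jsr_cvg d (N : submult_norm (deflated_space R d)) r :
  prob_vector d -> policy_growth_rate r ->
  jsr_seq N (deflated_family M d) @ \oo --> r.
Proof.
move=> d1 rr; pose U := annihv d.
have inU y : oblique_proj d *m y \in U by exact: oblique_proj_annihv.
have linphi : linear (fun p : deflated_space R d => vsval p.2).
  by move=> c p q; rewrite linearP.
pose phi : {linear deflated_space R d -> 'cV[R]_n} :=
  HB.pack (fun p : deflated_space R d => vsval p.2)
    (GRing.isLinear.Build _ _ _ _ _ linphi).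
apply: (@policy_family_jsr_cvg d _ _ (@deflated_op d) phi
  (fun x => (0, vsproj U (oblique_proj d *m x))) _ _ _ id) => //.
- exact: deflated_op_linear.
- by move=> Y x; rewrite lfunE /= restr_mxE vsprojK // -!mulmxA.
- by move=> p; exists (one_hot R p) => //; exact: one_hot_policy.
move=> mu Hmu k; apply/lfunP => p.
(* The first block column is zero, so the second component evolves alone. *)
have sndE j : vsval (iter_comp (deflated_map M d \o mu) j p).2
    = oblique_proj d *m policy_prod mu j *m vsval p.2.
  rewrite -(iter_comp_restr (U := U) _ _ d1) //; congr vsval.
  by elim: j => [|j IH] /=; rewrite ?id_lfunE // !comp_lfunE lfunE /= IH.
rewrite [LHS]/= comp_lfunE /= lfunE [RHS]lfunE /= /deflated_fun /deflated_op_fun.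
rewrite sndE !mulmxA; congr pair; apply: val_inj.
rewrite /= !restr_mxE -?mulmxA ?inU // sndE !mulmxA.
by rewrite -[_ *m oblique_proj d *m oblique_proj d]mulmxA oblique_projK.
Qed.

End PolicyProducts.

Theorem theorem3 (R : realType) (S A : finType) (M : mdp R S A)
    (d : 'cV[R]_(npairs S A)) (hd : prob_vector d)
    (Nd : submult_norm (deflated_space R d))
    (N0 : submult_norm (deflated_space R (uniform_vector R (npairs S A))))
    (Nbar : submult_norm (subvs_of (annihv (ones R (npairs S A))))) :
  let rho_d := jsr Nd (deflated_family M d) in
  let rho_0 := jsr N0 (deflated_family M (uniform_vector R (npairs S A))) in
  let rho_bar := jsr Nbar (projected_family M) in
  [/\ cvgn (jsr_seq Nd (deflated_family M d)),
      cvgn (jsr_seq N0 (deflated_family M (uniform_vector R (npairs S A))))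
    & cvgn (jsr_seq Nbar (projected_family M))]
  /\ [/\ rho_d = rho_bar, rho_bar <= discount M & rho_d = rho_0].
Proof.
have [r rr rg] := exists_policy_growth_rate M.
have cd := deflated_jsr_cvg Nd hd rr.
have c0 := deflated_jsr_cvg N0 (uniform_vector_prob M) rr.
have cb := projected_jsr_cvg Nbar rr.
rewrite /jsr !(cvg_lim (@Rhausdorff _) cd, cvg_lim (@Rhausdorff _) c0,
  cvg_lim (@Rhausdorff _) cb).
by split; split=> //; apply/cvg_ex; exists r.
Qed.
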